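(* Let $\mu$ be a monotone measure on $(X,\mathcal{B})$ which is continuous at $\emptyset$, and let $\mathcal{S}=\mathcal{S}^{P+}$ or $\mathcal{S}=\mathcal{S}^{P+}_\mu$. Let $\{f_n\}_{n\in\mathbb{N}}$ be a decreasing sequence of measurable functions on $X$ converging pointwise to $f$, and assume that $\int^{\downarrow}_{\mathcal{S}} f_1\,d\mu<\infty$. Then $$\int^{\downarrow}_{\mathcal{S}} f_n\,d\mu\ \searrow\ \int^{\downarrow}_{\mathcal{S}} f\,d\mu\qquad(n\to\infty),$$ i.e. the integrals are decreasing in $n$ and converge to $\int^{\downarrow}_{\mathcal{S}} f\,d\mu$.
   Context: $(X,\mathcal{B})$ is a measurable space ($\mathcal{B}$ a $\sigma$-algebra on $X$). Measurable functions (including the limit $f$) are real-valued. A monotone measure is a set function $\mu:\mathcal{B}\to[0,\infty)$ with $\mu(\emptyset)=0$ and $\mu(A)\le\mu(B)$ whenever $A\subset B$; throughout, every monotone measure is assumed to be continuous from above and below, i.e. $A_n\nearrow A$ or $A_n\searrow A$ implies $\mu(A_n)\to\mu(A)$. Continuity at $\emptyset$ means $A_n\searrow\emptyset$ implies $\mu(A_n)\to 0$. No additivity is assumed. A simple function is a finite or infinite sequence of pairs $\varphi=\{(a_k,A_k)\}_k$ with $a_k\in\mathbb{R}$, $A_k\in\mathcal{B}$; it is identified with the function $\varphi(x)=\sum_k a_k 1_{A_k}(x)$ ($1_A$ the indicator function of $A$), but its basic sum $\mu(\varphi)=\sum_k a_k\mu(A_k)$ depends on the sequence of pairs. A partition of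 $X$ is a family of pairwise disjoint sets in $\mathcal{B}$ (possibly empty) with union $X$. The classes are: - $\mathcal{S}^{P+}$: all finite sequences $\{(a_k,A_k)\}_{k=1}^n$, $n\in\mathbb{N}$, with $a_k\ge 0$ and $\{A_k\}_k$ a partition of $X$; - $\mathcal{S}^{P+}_\mu$: all infinite sequences $\{(a_k,A_k)\}_{k=1}^\infty$ with $a_k\ge 0$, $\sum_k a_k\mu(A_k)<\infty$ and $\{A_k\}_k$ a partition of $X$. For a class $\mathcal{S}$ and a measurable function $f$, $U(\mathcal{S},f)=\{\varphi\in\mathcal{S}:\varphi(x)\ge f(x)\ \forall x\in X\}$ and $\int^{\downarrow}_{\mathcal{S}} f\,d\mu=\inf\{\mu(\varphi):\varphi\in U(\mathcal{S},f)\}$, with $\inf\emptyset=+\infty$. *)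

(* Defs.v *)
From mathcomp Require Import all_boot all_order all_algebra.
From mathcomp Require Import all_classical all_reals all_analysis.
Import Order.TTheory GRing.Theory Num.Theory.
Import numFieldNormedType.Exports.

Set Implicit Arguments.
Unset Strict Implicit.
Unset Printing Implicit Defensive.

Local Open Scope classical_set_scope.
Local Open Scope ring_scope.

Definition continuous_at_empty (d : measure_display) (X : measurableType d)
    (R : realType) (mu : set X -> R) : Prop :=
  forall A : nat -> set X, (forall n, measurable (A n)) ->
    (forall n, A n.+1 `<=` A n) -> \bigcap_n A n = set0 ->
    mu (A n) @[n --> \oo] --> (0 : R).

(* Only the restriction of mu to the measurable sets is meaningful; its values
   on other sets are never constrained nor used.  Continuity from below and
   from above is part of the notion. *)
Record monotone_measure (d : measure_display) (X : measurableType d)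
    (R : realType) (mu : set X -> R) : Prop := MonotoneMeasure {
  mm_empty : mu set0 = 0 ;
  mm_ge0 : forall A, measurable A -> 0 <= mu A ;
  mm_mono : forall A B, measurable A -> measurable B ->
    A `<=` B -> mu A <= mu B ;
  mm_cont_below : forall A : nat -> set X, (forall n, measurable (A n)) ->
    (forall n, A n `<=` A n.+1) ->
    mu (A n) @[n --> \oo] --> mu (\bigcup_n A n) ;
  mm_cont_above : forall A : nat -> set X, (forall n, measurable (A n)) ->
    (forall n, A n.+1 `<=` A n) ->
    mu (A n) @[n --> \oo] --> mu (\bigcap_n A n) }.

(* A finite or infinite sequence of pairs (a_k, A_k), indexed from 0.
   Measurability of the A_k is imposed by is_partition. *)
Inductive simple_seq (X : Type) (R : Type) : Type :=
| FinSeq (n : nat) (a : 'I_n -> R) (A : 'I_n -> set X)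
| InfSeq (a : nat -> R) (A : nat -> set X).

(* Values are taken in \bar R because a general infinite sum may diverge. *)
Definition simple_eval (X : Type) (R : realType) (phi : simple_seq X R)
    (x : X) : \bar R :=
  match phi with
  | FinSeq _ a A => (\sum_k (a k * \1_(A k) x)%:E)%E
  | InfSeq a A => (\sum_(0 <= k <oo) (a k * \1_(A k) x)%:E)%E
  end.

Definition basic_sum (X : Type) (R : realType) (mu : set X -> R)
    (phi : simple_seq X R) : \bar R :=
  match phi with
  | FinSeq _ a A => (\sum_k (a k * mu (A k))%:E)%E
  | InfSeq a A => (\sum_(0 <= k <oo) (a k * mu (A k))%:E)%E
  end.

(* Unlike classical_sets.partition, blocks may be empty. *)
Definition is_partition (d : measure_display) (X : measurableType d)
    (I : Type) (A : I -> set X) : Prop :=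
  [/\ forall k, measurable (A k), trivIset setT A & \bigcup_k A k = setT].

Definition SPplus (d : measure_display) (X : measurableType d) (R : realType)
    : set (simple_seq X R) :=
  [set phi | match phi with
             | FinSeq n a A =>
                 [/\ (0 < n)%N, forall k, 0 <= a k & is_partition A]
             | InfSeq _ _ => False
             end].

Definition SPplus_mu (d : measure_display) (X : measurableType d)
    (R : realType) (mu : set X -> R) : set (simple_seq X R) :=
  [set phi | match phi with
             | FinSeq _ _ _ => False
             | InfSeq a A => [/\ forall k, 0 <= a k,
                   (basic_sum mu (InfSeq a A) < +oo)%E & is_partition A]
             end].

Definition upper_class (X : Type) (R : realType) (S : set (simple_seq X R))
    (f : X -> R) : set (simple_seq X R) :=
  [set phi | S phi /\ forall x, ((f x)%:E <= simple_eval phi x)%E].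

(* ereal_inf set0 = +oo, as required when no majorant exists. *)
Definition upper_integral (X : Type) (R : realType) (mu : set X -> R)
    (S : set (simple_seq X R)) (f : X -> R) : \bar R :=
  ereal_inf [set basic_sum mu phi | phi in upper_class S f].

(* Main.v *)
(* Let (a_k, A_k) majorize f and (b_j, D_j) majorize f_0.  Put
   B_k = A_k `&` [f_n <= a_k + t_k] with t_k > 0 and
   \sum_k t_k mu(A_k) <= e / 2.  The pairs (a_k + t_k, B_k) together with
   (b_j, D_j `\` \bigcup_k B_k) majorize f_n.  Since D_j `\` \bigcup_k B_k
   decreases to set0 as n grows, continuity at the empty set and dominated
   convergence of series make the contribution of the second family at most
   e / 2 for n large. *)
Require Import Defs.
From mathcomp Require Import all_boot all_order all_algebra.
From mathcomp Require Import all_classical all_reals all_analysis.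
Import Order.TTheory GRing.Theory Num.Theory.
Import numFieldNormedType.Exports.

Local Open Scope classical_set_scope.
Local Open Scope ring_scope.

(** * Series with nonnegative terms *)

(** Dominated convergence for series: cut at an [N] beyond which the tail of [v] is below [e / 2];
    what remains is a finite sum of null sequences. *)
Lemma nneseries_dominated_le (R : realType) (u : nat -> nat -> R)
    (v : nat -> R) :
  (forall n j, 0 <= u n j) -> (forall n j, u n j <= v j) ->
  (\sum_(0 <= j <oo) (v j)%:E < +oo)%E ->
  (forall j, u n j @[n --> \oo] --> (0 : R)) ->
  forall e, 0 < e ->
    \forall n \near \oo, (\sum_(0 <= j <oo) (u n j)%:E <= e%:E)%E.
Proof.
move=> u0 uv voo cu e e0.
have v0 j : 0 <= v j by apply: le_trans (u0 0%N j) (uv 0%N j).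
have e20 : 0 < e / 2 by rewrite divr_gt0.
have [N _ /(_ N (leqnn N)) /= tailN] : \forall N \near \oo,
    (\sum_(N <= j <oo) (v j)%:E < (e / 2)%:E)%E.
  have tail0 := @nneseries_tail_cvg R (EFin \o v) xpredT voo (fun j _ => v0 j).
  exact: (tail0 _ (@open_ereal_lt' _ 0%E (e / 2)%:E e20)).
have headN : \sum_(0 <= j < N) u n j @[n --> \oo] --> (0 : R).
  elim: N {tailN} => [|N IH].
    by under eq_fun do rewrite big_nil; apply: cvg_cst.
  under eq_fun do rewrite big_nat_recr//=.
  by have := cvgD IH (cu N); rewrite addr0; apply.
have /cvgr_lt/(_ _ e20) := headN.
apply: filterS => n /= hn.
rewrite (@nneseries_split _ _ 0 N)/=; last by move=> k _; rewrite lee_fin.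
rewrite [X in (_ <= X%:E)%E]splitr EFinD.
apply: leeD.
  by rewrite sumEFin lee_fin ltW.
apply: le_trans (ltW tailN).
by apply: lee_nneseries => j *; rewrite lee_fin.
Qed.

Lemma eseries_finite_support (R : realFieldType) (f : nat -> \bar R) N :
  (forall k, (N <= k)%N -> f k = 0%E) ->
  (\sum_(0 <= k <oo) f k = \sum_(k < N) f k)%E.
Proof.
move=> f0; apply: lim_near_cst => //; exists N => // n /= Nn.
rewrite (@big_cat_nat _ _ _ N)//= [X in (_ + X)%E]big_nat_cond.
by rewrite [X in (_ + X)%E]big1 ?adde0 ?big_mkord// => k /andP[/andP[/f0]].
Qed.

(** Serves to list two infinite families of coefficients or blocks as a single sequence. *)
Definition interleave {T : Type} (u v : nat -> T) (k : nat) : T :=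
  if odd k then v k./2 else u k./2.

Lemma interleave_double (T : Type) (u v : nat -> T) k :
  interleave u v k.*2 = u k.
Proof. by rewrite /interleave odd_double doubleK. Qed.

Lemma interleave_doubleS (T : Type) (u v : nat -> T) k :
  interleave u v k.*2.+1 = v k.
Proof. by rewrite /interleave /= odd_double uphalf_double. Qed.

Lemma interleave_ind (T : Type) (P : T -> Prop) (u v : nat -> T) :
  (forall k, P (u k)) -> (forall k, P (v k)) -> forall k, P (interleave u v k).
Proof. by move=> Pu Pv k; rewrite /interleave; case: ifP. Qed.

(** Nonnegativity bounds the partial sum up to [n] by the one up to [n.*2], which splits exactly
    into [n] terms of each family. *)
Lemma nneseries_interleave_le {R : realType} {u v : nat -> \bar R} :
  (forall k, 0 <= u k)%E -> (forall k, 0 <= v k)%E ->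
  (\sum_(0 <= k <oo) interleave u v k <=
   \sum_(0 <= k <oo) u k + \sum_(0 <= k <oo) v k)%E.
Proof.
move=> u0 v0; have w0 k : (0 <= interleave u v k)%E.
  by apply: (interleave_ind _ (fun x => 0 <= x)%E).
apply: lime_le; first by apply: is_cvg_nneseries => *.
apply: nearW => n.
have hn : (\sum_(0 <= k < n) interleave u v k <=
           \sum_(0 <= k < n.*2) interleave u v k)%E.
  rewrite [leRHS](@big_cat_nat _ _ _ n)//= ?leeDl ?sume_ge0//.
  by rewrite -addnn leq_addr.
apply: (le_trans hn).
have -> : (\sum_(0 <= k < n.*2) interleave u v k =
           \sum_(0 <= k < n) u k + \sum_(0 <= k < n) v k)%E.
  elim: n {hn} => [|n IH]; first by rewrite !big_nil adde0.
  rewrite doubleS !big_nat_recr//= interleave_double interleave_doubleS.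
  by rewrite IH -!addeA; congr (_ + _)%E; rewrite addeCA.
by apply: leeD; apply: nneseries_lim_ge.
Qed.

(** * Upper integrals as infima over infinite majorants *)

Section majorants.
Context {R : realType} {d : measure_display} {X : measurableType d}.
Implicit Types (f : X -> R) (mu : set X -> R) (a : nat -> R).
Implicit Types (A : nat -> set X) (phi : simple_seq X R).

(** Nonnegativity allows term [k] to be pulled out of the series; disjointness makes all other terms
    vanish at [x]. *)
Lemma simple_eval_Inf {a A} {k : nat} {x : X} : is_partition A ->
  (forall j, 0 <= a j) -> A k x -> simple_eval (InfSeq a A) x = (a k)%:E.
Proof.
move=> [_ tA _] a0 Akx /=.
rewrite (nneseriesD1 (n := k))//; last first.
  by move=> j _; rewrite lee_fin mulr_ge0.
rewrite indicE mem_set// mulr1 eseries0 ?adde0// => j _ /= jk.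
rewrite indicE memNset ?mulr0// => Ajx.
have /eqP := tA j k I I (ex_intro _ x (conj Ajx Akx)).
by rewrite (negPf jk).
Qed.

Lemma simple_eval_Fin {n} {a : 'I_n -> R} {A : 'I_n -> set X} {k : 'I_n} {x} :
  is_partition A -> A k x -> simple_eval (FinSeq a A) x = (a k)%:E.
Proof.
move=> [_ tA _] Akx /=.
rewrite (bigD1 k)//= indicE mem_set// mulr1 big1 ?adde0// => j jk.
rewrite indicE memNset ?mulr0// => Ajx.
have /eqP := tA j k I I (ex_intro _ x (conj Ajx Akx)).
by rewrite (negPf jk).
Qed.

(* A finite sequence is encoded as an infinite one padded with blocks
   (0, set0), so that both classes are covered by the parameter fin. *)
Definition majorant mu (fin : Prop) f a A : Prop :=
  [/\ forall k, 0 <= a k,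
      is_partition A,
      (basic_sum mu (InfSeq a A) < +oo)%E,
      forall k x, A k x -> f x <= a k
    & fin -> \forall k \near \oo, A k = set0].

Definition majorant_integral mu fin f : \bar R :=
  ereal_inf [set basic_sum mu (InfSeq aA.1 aA.2) |
             aA in [set aA | majorant mu fin f aA.1 aA.2]].

(** At [x] the simple function takes the coefficient of the block containing [x], so majorization
    can be tested block by block. *)
Lemma upper_integral_SPplus_mu mu f :
  upper_integral mu (SPplus_mu mu) f = majorant_integral mu False f.
Proof.
congr ereal_inf; apply/seteqP; split => y [] /=.
  move=> [n a A [[]]//|a A [[a0 fin pA] maj] <-].
  exists (a, A) => //; split=> //= k x Akx.
  by have := maj x; rewrite (simple_eval_Inf pA a0 Akx) lee_fin.
move=> [a A] /= [a0 pA fin maj _] <-; exists (InfSeq a A) => //; split=> // x.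
have [_ _ cA] := pA.
have [k _ Akx] : (\bigcup_k A k) x by rewrite cA.
by rewrite (simple_eval_Inf pA a0 Akx) lee_fin; apply: maj Akx.
Qed.

Lemma upper_integral_SPplus mu f : mu set0 = 0 ->
  upper_integral mu (@SPplus d X R) f = majorant_integral mu True f.
Proof.
move=> mu0; congr ereal_inf; apply/seteqP; split => y [] /=.
  move=> [n a A [[n0 a0 pA] maj] <-|a A [[]]//].
  have [mA tA cA] := pA.
  (* Padding from index [n] on: the blocks are empty, so the basic sum is unchanged because
     [mu set0 = 0]. *)
  pose a' k := if insub k is Some i then a i else 0.
  pose A' k := if insub k is Some i then A i else set0.
  have a'E (i : 'I_n) : a' i = a i by rewrite /a' valK.
  have A'E (i : 'I_n) : A' i = A i by rewrite /A' valK.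
  have A'0 k : (n <= k)%N -> A' k = set0.
    by move=> nk; rewrite /A' insubN// -leqNgt.
  have A'ord k x : A' k x -> exists2 i : 'I_n, k = i & A i x.
    have [kn|/A'0 ->//] := ltnP k n.
    by rewrite -[k]/(nat_of_ord (Ordinal kn)) A'E; exists (Ordinal kn).
  have sumE : basic_sum mu (InfSeq a' A') = (\sum_k (a k * mu (A k))%:E)%E.
    rewrite /= (@eseries_finite_support _ _ n).
      by apply: eq_bigr => i _; rewrite a'E A'E.
    by move=> k /A'0 ->; rewrite mu0 mulr0.
  exists (a', A') => //; split => //=.
  - by move=> k; rewrite /a'; case: insubP.
  - split.
    + by move=> k; rewrite /A'; case: insubP.
    + move=> i j _ _ [x [/A'ord[i' -> Ai] /A'ord[j' -> Aj]]].
      by congr nat_of_ord; apply: tA => //; exists x.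
    + rewrite -subTset => x _.
      have [k _ Akx] : (\bigcup_k A k) x by rewrite cA.
      by exists (k : nat) => //; rewrite A'E.
  - by move: sumE => /= ->; rewrite sumEFin ltry.
  - move=> k x /A'ord[i -> Ai]; rewrite a'E.
    by have := maj x; rewrite (simple_eval_Fin pA Ai) lee_fin.
  - by move=> _; exists n => // k /= nk; exact: A'0.
move=> [a A] /= [a0 pA fin maj /(_ I)[N _ AN]] <-.
have [mA tA cA] := pA.
(* Length [N.+1] instead of [N] guarantees a nonempty sequence; block [N] is already empty. *)
pose b (k : 'I_N.+1) := a k; pose B (k : 'I_N.+1) := A k.
have pB : is_partition B.
  split.
  - by move=> k; exact: mA.
  - by move=> i j _ _ ij; apply: val_inj; exact: tA ij.
  - rewrite -subTset => x _.
    have [k _ Akx] : (\bigcup_k A k) x by rewrite cA.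
    have [kN|Nk] := ltnP k N.+1; first by exists (Ordinal kN).
    by move: Akx; rewrite AN//= ltnW.
exists (FinSeq b B).
  split; first by split => // k; exact: a0.
  move=> x; have [_ _ cB] := pB.
  have [k _ Akx] : (\bigcup_k B k) x by rewrite cB.
  by rewrite (simple_eval_Fin pB Akx) lee_fin; exact: maj Akx.
rewrite /= (@eseries_finite_support _ _ N.+1)// => k /ltnW /AN ->.
by rewrite mu0 mulr0.
Qed.

(** * Merging two majorants *)

Lemma is_partition_interleave (U V : nat -> set X) :
  (forall k, measurable (U k)) -> trivIset setT U -> is_partition V ->
  is_partition (interleave U (fun j => V j `\` \bigcup_k U k)).
Proof.
move=> mU tU [mV tV cV]; split.
- apply: (interleave_ind _ measurable) => // j; apply: measurableD => //.
  exact: bigcup_measurable.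
(* Each index is split into parity and half. Equal parities reduce to disjointness within one
   family; mixed parities contradict the removal of the union of [U]. *)
- move=> i j _ _ [x [+ +]]; rewrite -(odd_double_half i) -(odd_double_half j).
  case: (odd i) (odd j) => -[]; rewrite ?interleave_doubleS ?interleave_double.
  + by move=> [Vi _] [Vj _]; congr (_ + _.*2)%N; apply: tV => //; exists x.
  + by move=> [_ +] Uj; case; exists (j./2).
  + by move=> Ui [_]; case; exists (i./2).
  + by move=> Ui Uj; congr (_ + _.*2)%N; apply: tU => //; exists x.
- rewrite -subTset => x _.
  have [[k _ Ukx]|nUx] := pselect ((\bigcup_k U k) x).
    by exists k.*2 => //; rewrite interleave_double.
  have [k _ Vkx] : (\bigcup_k V k) x by rewrite cV.
  by exists k.*2.+1 => //; rewrite interleave_doubleS.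
Qed.

Lemma ge_majorant_integral {mu fin f a A} : majorant mu fin f a A ->
  (majorant_integral mu fin f <= basic_sum mu (InfSeq a A))%E.
Proof. by move=> maj; apply: ereal_inf_lbound; exists (a, A). Qed.

Lemma majorant_le mu fin f g a A : (forall x, f x <= g x) ->
  majorant mu fin g a A -> majorant mu fin f a A.
Proof.
move=> fg [a0 pA fA maj Afin]; split => // k x Akx.
exact: le_trans (fg x) (maj k x Akx).
Qed.

Lemma le_majorant_integral mu fin f g : (forall x, f x <= g x) ->
  (majorant_integral mu fin f <= majorant_integral mu fin g)%E.
Proof.
move=> fg; apply: ereal_inf_le_tmp => _ [[a A] maj <-].
by exists (a, A) => //; apply: majorant_le maj.
Qed.

(** Where [f_ n] still exceeds the raised coefficients of the first majorant, the second one takes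
    over: it works for every [n] since [f_ n <= f_ 0]. *)
Lemma majorant_approx {mu fin} {f_ : nat -> X -> R} {f a A b D e} :
  monotone_measure mu -> continuous_at_empty mu ->
  (forall n, measurable_fun setT (f_ n)) ->
  (forall n x, f_ n.+1 x <= f_ n x) ->
  (forall x, f_ n x @[n --> \oo] --> f x) ->
  majorant mu fin f a A -> majorant mu fin (f_ 0%N) b D -> 0 < e ->
  exists n, (majorant_integral mu fin (f_ n) <=
             basic_sum mu (InfSeq a A) + e%:E)%E.
Proof.
move=> [_ mu0 mu_mono _ _] mu_empty mf f_decr f_cvg.
move=> [a0 [mA tA cA] fA majA finA] [b0 pD fD majD finD] e0.
have [mD tD cD] := pD.
have e20 : 0 < e / 2 by rewrite divr_gt0.
have f_le0 n x : f_ n x <= f_ 0%N x.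
  by elim: n => // n; apply: le_trans.
have muA1 k : 0 < 1 + mu (A k) by rewrite ltr_pwDl// mu0.
(* The powers of 2 make the total extra cost at most [e / 2]; adding 1 to [mu (A k)] avoids division
   by zero. *)
pose t k := e / 2 / (2 ^ k.+1)%:R / (1 + mu (A k)).
have t0 k : 0 < t k by rewrite !divr_gt0// ltr0n expn_gt0.
have tmu k : t k * mu (A k) <= e / 2 / (2 ^ k.+1)%:R.
  rewrite /t -mulrA ler_piMr//; first by rewrite divr_ge0// ltW.
  by rewrite mulrC ler_pdivrMr// mul1r lerDr.
pose B n k := A k `&` [set x | f_ n x <= a k + t k].
have mB n k : measurable (B n k).
  apply: measurableI => //.
  have -> : [set x | f_ n x <= a k + t k] =
      setT `&` f_ n @^-1` `]-oo, a k + t k].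
    by rewrite setTI; apply/seteqP; split => x /=; rewrite in_itv.
  exact: mf.
have BA n k : B n k `<=` A k by move=> x [].
have BS n k : B n k `<=` B n.+1 k.
  by move=> x [Akx /= h]; split => //=; apply: le_trans (f_decr n x) h.
pose C n j := D j `\` \bigcup_k B n k.
have mC n j : measurable (C n j).
  by apply: measurableD => //; apply: bigcup_measurable.
have CD n j : C n j `<=` D j by move=> x [].
have cvgC j : mu (C n j) @[n --> \oo] --> (0 : R).
  apply: mu_empty => //.
    by move=> n x [Dx nB]; split => // -[k _ /BS Bx]; apply: nB; exists k.
  rewrite -subset0 => x Cx.
  have [k _ Akx] : (\bigcup_k A k) x by rewrite cA.
  (* Since [t k] is strictly positive, the limit lies strictly below the threshold; hence some
     [f_ N x] does too, which puts [x] into [B N k], outside [C N j]. *)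
  have lt_f : f x < a k + t k.
    by apply: le_lt_trans (majA k x Akx) _; rewrite ltrDl.
  have [N _ /(_ N (leqnn N)) /= hN] := cvgr_lt _ (f_cvg x) _ lt_f.
  by have [_] := Cx N I; case; exists k => //; split => //=; apply: ltW.
have [n _ /(_ n (leqnn n)) /= hn] : \forall n \near \oo,
    (\sum_(0 <= j <oo) (b j * mu (C n j))%:E <= (e / 2)%:E)%E.
  apply: (@nneseries_dominated_le _ _ (fun j => b j * mu (D j))) => //.
  - by move=> n j; rewrite mulr_ge0// mu0.
  - by move=> n j; rewrite ler_wpM2l// mu_mono.
  - by move=> j; rewrite -[0](mulr0 (b j)); apply: cvgMr.
exists n.
pose c := interleave (fun k => a k + t k) b.
pose E := interleave (B n) (C n).
have sum_le : (basic_sum mu (InfSeq c E) <=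
    basic_sum mu (InfSeq a A) + e%:E)%E.
  rewrite /= (eq_eseriesr (g := interleave
    (fun k => ((a k + t k) * mu (B n k))%:E)
    (fun k => (b k * mu (C n k))%:E))); last first.
    by move=> k _; rewrite /c /E /interleave; case: ifP.
  apply: le_trans (nneseries_interleave_le _ _) _.
  - by move=> k; rewrite lee_fin mulr_ge0 ?addr_ge0 ?mu0// ltW.
  - by move=> k; rewrite lee_fin mulr_ge0 ?mu0.
  rewrite [X in (_ + X%:E)%E]splitr EFinD addeA leeD//.
  (* The geometric bounds [tmu] on [t k * mu (A k)] sum to at most [e / 2]. *)
  apply: le_trans (epsilon_trick xpredT _ (ltW e20)); last first.
    by move=> k; rewrite lee_fin mulr_ge0// mu0.
  apply: lee_nneseries => [k _ _|k _].
    by rewrite lee_fin mulr_ge0 ?addr_ge0 ?mu0// ltW.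
  rewrite -EFinD lee_fin.
  apply: (@le_trans _ _ ((a k + t k) * mu (A k))).
    by rewrite ler_wpM2l ?mu_mono// addr_ge0// ltW.
  by rewrite mulrDl lerD2l.
apply: (le_trans (ge_majorant_integral _) sum_le).
split => //.
- by apply: (interleave_ind _ (fun x => 0 <= x)) => // k;
    rewrite addr_ge0// ltW.
- apply: is_partition_interleave => // i j _ _ [x [Bi Bj]].
  by apply: tA => //; exists x; split; [exact: BA Bi|exact: BA Bj].
- by apply: le_lt_trans sum_le _; rewrite lte_add_pinfty// ltry.
- move=> k x; rewrite /c /E /interleave; case: ifP => _.
    by move=> /CD /majD; apply: le_trans.
  by case.
- move=> hfin; have [N _ AN] := finA hfin; have [M _ DM] := finD hfin.
  (* Index [k] of the merged sequence reads index [k./2] of one family, hence the doubling. *)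
  exists (maxn N M).*2 => // k /= hk.
  have : (maxn N M <= k./2)%N by rewrite -(doubleK (maxn N M)) half_leq.
  rewrite geq_max => /andP[Nk Mk]; rewrite /E /interleave; case: ifP => _.
    by rewrite -subset0 -(DM _ Mk); exact: CD.
  by rewrite -subset0 -(AN _ Nk); exact: BA.
Qed.

(** * Passage to the limit *)

(** A nonincreasing sequence of extended reals converges to its infimum. This infimum is bounded
    below by monotonicity, as [f <= f_ n], and above by [majorant_approx] with arbitrary [e]. *)
Lemma cvg_majorant_integral mu fin (f_ : nat -> X -> R) f :
  monotone_measure mu -> continuous_at_empty mu ->
  (forall n, measurable_fun setT (f_ n)) ->
  (forall n x, f_ n.+1 x <= f_ n x) ->
  (forall x, f_ n x @[n --> \oo] --> f x) ->
  (majorant_integral mu fin (f_ 0%N) < +oo)%E ->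
  majorant_integral mu fin (f_ n) @[n --> \oo] --> majorant_integral mu fin f.
Proof.
move=> mu_mm mu_empty mf f_decr f_cvg.
(* An infimum below [+oo] is taken over a nonempty set, which yields a majorant of [f_ 0]. *)
move=> /ereal_inf_lt[_ [[b D] majD _] _].
have f_noninc x : {homo f_^~ x : n m / (n <= m)%N >-> m <= n}.
  by apply/nonincreasing_seqP => n; exact: f_decr.
have f_le n x : f x <= f_ n x.
  rewrite -(cvg_lim _ (f_cvg x))//; apply: nonincreasing_cvgn_ge => //.
  by apply/cvg_ex; exists (f x).
suff -> : majorant_integral mu fin f =
    ereal_inf (range (fun n => majorant_integral mu fin (f_ n))).
  by apply: ereal_nonincreasing_cvgn => n m nm; apply: le_majorant_integral
    => x; exact: f_noninc.
apply/eqP; rewrite eq_le; apply/andP; split.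
  apply: le_ereal_inf_tmp => _ [n _ <-]; apply: le_majorant_integral.
  exact: f_le.
apply: le_ereal_inf_tmp => _ [[a A] /= majA <-].
apply/lee_addgt0Pr => e e0.
have [n hn] :=
  majorant_approx mu_mm mu_empty mf f_decr f_cvg majA majD e0.
by apply: le_trans hn; apply: ereal_inf_lbound; exists n.
Qed.

End majorants.

Theorem theorem13 (R : realType) (d : measure_display) (X : measurableType d)
    (mu : set X -> R) (S : set (simple_seq X R))
    (f_ : nat -> X -> R) (f : X -> R)
    (mu_mm : monotone_measure mu) (mu_cont0 : continuous_at_empty mu)
    (S_class : S = @SPplus d X R \/ S = SPplus_mu mu)
    (mf_ : forall n, measurable_fun setT (f_ n))
    (f_decr : forall n x, f_ n.+1 x <= f_ n x)
    (f_cvg : forall x, f_ n x @[n --> \oo] --> f x)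
    (f0_fin : (upper_integral mu S (f_ 0%N) < +oo)%E) :
  (forall n, (upper_integral mu S (f_ n.+1) <= upper_integral mu S (f_ n))%E) /\
  upper_integral mu S (f_ n) @[n --> \oo] --> upper_integral mu S f.
Proof.
have [fin SE] : exists fin, upper_integral mu S = majorant_integral mu fin.
  case: S_class => ->.
    exists True; apply/funext => g; apply: upper_integral_SPplus.
    exact: mm_empty mu_mm.
  by exists False; apply/funext => g; exact: upper_integral_SPplus_mu.
rewrite SE in f0_fin *; split; last exact: cvg_majorant_integral.
by move=> n; exact: le_majorant_integral.
Qed.
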